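(* Let $G$ be a cubic graph admitting a 3-malleable vertex. Then $G$ is 2FH and all vertices of $G$ are 3-malleable.
   Context: Graphs are finite and connected, may have multiple (parallel) edges, and have no loops. The degree of a vertex is the number of edges incident to it; a cubic graph is a 3-regular graph. A $2$-factor of $G$ is a $2$-regular spanning subgraph (not necessarily connected; two parallel edges count as a $2$-regular component on two vertices), and a Hamiltonian cycle is a connected $2$-factor. A perfect matching is the edge set of a $1$-regular spanning subgraph. A Hamiltonian cycle $H$ extends a perfect matching $M$ if $M\subseteq E(H)$. A graph is 2FH (2-factor Hamiltonian) if it has a Hamiltonian cycle and each of its $2$-factors is a Hamiltonian cycle. For a vertex $v$, $\partial v$ denotes the set of edges incident to $v$. If $G$ admits a perfect matching and $v$ is a vertex of degree $t\ge 2$, then $v$ is $t$-malleable if for every perfect matching $M$ of $G$ there exist Hamiltonian cycles $H_1,\dots,H_{t-1}$ of $G$, all extending $M$, such that $\partial v - M\subset \bigcup_{i=1}^{t-1}E(H_i)$. (In particular, a graph with a $t$-malleable vertex admits a perfect matching.) *)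

(* Defs.v *)
From mathcomp Require Import all_boot.

Set Implicit Arguments.
Unset Strict Implicit.
Unset Printing Implicit Defensive.

(* Finite loopless multigraphs: edges form a type of their own, so distinct
   edges may have the same set of ends (parallel edges); requiring exactly two
   ends excludes loops. *)
Record multigraph := Multigraph {
  vertex : finType;
  edge : finType;
  ends : edge -> {set vertex};
  card_ends : forall e, #|ends e| = 2
}.

Section Multigraph.

Variable G : multigraph.

(* A set F of edges stands for the spanning subgraph (V(G), F). *)
Implicit Types (F M H : {set edge G}) (v : vertex G).

Definition boundary v : {set edge G} := [set e | v \in ends e].

Definition degree_in F v : nat := #|boundary v :&: F|.

Definition degree v : nat := #|boundary v|.

Definition regular_in (k : nat) F : Prop := forall v, degree_in F v = k.

Definition cubic : Prop := forall v, degree v = 3.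

Definition adjacent_in F : rel (vertex G) :=
  fun x y => [exists e in F, ends e == [set x; y]].

(* The graph with no vertex is not considered connected. *)
Definition connected_in F : Prop :=
  0 < #|vertex G| /\ forall x y, connect (adjacent_in F) x y.

Definition connected : Prop := connected_in [set: edge G].

Definition perfect_matching M : Prop := regular_in 1 M.

Definition two_factor F : Prop := regular_in 2 F.

Definition hamiltonian_cycle H : Prop := two_factor H /\ connected_in H.

Definition extends H M : Prop := M \subset H.

Definition two_factor_hamiltonian : Prop :=
  (exists H, hamiltonian_cycle H) /\
  (forall F, two_factor F -> hamiltonian_cycle F).

Definition malleable (t : nat) v : Prop :=
  [/\ exists M, perfect_matching M,
      degree v = t,
      2 <= t &
      forall M, perfect_matching M ->
        exists H : 'I_t.-1 -> {set edge G},
          (forall i, hamiltonian_cycle (H i) /\ extends (H i) M) /\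
          boundary v :\: M \subset \bigcup_(i < t.-1) H i].

End Multigraph.

(* Main.v *)
Require Import Defs.
From mathcomp Require Import all_boot.

(** A perfect matching inside a connected 2-factor [H] is determined by any one
    of its edges, since along [H] it must alternate with its complement.  Now
    let [F] be a 2-factor and [M] its complement.  Some Hamiltonian cycle [H]
    extends [M]; put [N = H - M] and [L = E - H], so that [F = N + L].
    Malleability applied to [L] and the edge of [N] at [v] gives a Hamiltonian
    cycle [L + B] with [B] a perfect matching inside [H] sharing an edge with
    [N]; hence [B = N] and [F = L + B] is Hamiltonian.  For any other vertex and
    any [M], the 2-factors [M + N] and [M + L] are then Hamiltonian cycles that
    together cover all edges. *)

Section RegularSubgraphs.

Set Implicit Arguments.
Unset Strict Implicit.

Variable G : multigraph.
Implicit Types (A B F H M : {set edge G}) (u v x y : vertex G).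

Lemma regular_inD k l F M :
  M \subset F -> regular_in k F -> regular_in l M ->
  regular_in (k - l) (F :\: M).
Proof.
move=> sMF regF regM v; rewrite /degree_in setIDA cardsD.
by rewrite -setIA (setIidPr sMF) -(regF v) -(regM v).
Qed.

Lemma regular_in_compl k F :
  cubic G -> regular_in k F -> regular_in (3 - k) (~: F).
Proof.
move=> cubG regF; rewrite -setTD; apply: regular_inD regF; first exact: subsetT.
by move=> v; rewrite /degree_in setIT; apply: cubG.
Qed.

Lemma perfect_matching_edge M v e :
  perfect_matching M -> v \in ends e -> e \in M -> boundary v :&: M = [set e].
Proof.
move=> pmM ve eM; apply/esym/eqP; rewrite eqEcard cards1 -/(degree_in M v) pmM andbT.
by rewrite sub1set inE eM inE ve.
Qed.

(** Only two edges of [H] meet [v], so a perfect matching inside [H] that misses [e] must use the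
    other one: its edge at [v] depends only on [H] and [e]. *)
Lemma perfect_matching_avoid H M v e :
  two_factor H -> M \subset H -> perfect_matching M ->
  v \in ends e -> e \in H -> e \notin M ->
  boundary v :&: M = (boundary v :&: H) :\ e.
Proof.
move=> tfH sMH pmM ve eH eNM; apply/eqP; rewrite eqEcard; apply/andP; split.
  by rewrite subsetD1 (setIS _ sMH) in_setI (negPf eNM) andbF.
have := cardsD1 e (boundary v :&: H).
by rewrite -/(degree_in H v) -/(degree_in M v) tfH pmM !inE ve eH add1n => -[<-].
Qed.

Lemma perfect_matching_in_hamiltonian_eq H A B e :
  hamiltonian_cycle H -> A \subset H -> B \subset H ->
  perfect_matching A -> perfect_matching B -> e \in A -> e \in B -> A = B.
Proof.
move=> [tfH [_ conH]] sAH sBH pmA pmB eA eB.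
(* [S] collects the vertices where [A] and [B] use the same edge. Closed under adjacency in [H] and
   containing an end of [e], it is everything. *)
pose S := [pred x | boundary x :&: A == boundary x :&: B].
have stepS x y : adjacent_in H x y -> S x -> S y.
  case/existsP=> f /andP[fH /eqP ends_f] /eqP Sx; apply/eqP.
  have xf : x \in ends f by rewrite ends_f set21.
  have yf : y \in ends f by rewrite ends_f set22.
  have fAB : (f \in A) = (f \in B).
    by move/setP/(_ f): Sx; rewrite !inE xf.
  (* At [y], both matchings use [f], or both use the other edge of [H]. *)
  have [fA|fNA] := boolP (f \in A).
    by rewrite (@perfect_matching_edge A y f) // (@perfect_matching_edge B y f) -?fAB.
  rewrite (@perfect_matching_avoid H A y f) //.
  by rewrite (@perfect_matching_avoid H B y f) -?fAB.
have pathS p : forall x, path (adjacent_in H) x p -> S x -> S (last x p).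
  elim: p => //= y p IHp x /andP[xy yp] Sx.
  exact: IHp yp (stepS _ _ xy Sx).
have has_end f : exists x, x \in ends f.
  by apply/set0Pn; rewrite -card_gt0 card_ends.
have [u ue] := has_end e.
have Su : S u by rewrite /= (@perfect_matching_edge A u e) // (@perfect_matching_edge B u e).
apply/setP=> f; have [x xf] := has_end f.
have /connectP[p up x_p] := conH u x.
have /eqP/setP/(_ f) := pathS p u up Su.
by rewrite -x_p !inE xf.
Qed.

Lemma malleable_extend v M e :
  malleable 3 v -> perfect_matching M -> e \in boundary v -> e \notin M ->
  exists H, [/\ hamiltonian_cycle H, M \subset H & e \in H].
Proof.
case=> _ _ _ mall pmM ev eNM; have [H [hamH /subsetP cov]] := mall M pmM.
have /bigcupP[i _ eHi] : e \in \bigcup_(i < 2) H i.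
  by apply: cov; rewrite inE eNM.
by exists (H i); have [? ?] := hamH i.
Qed.

Lemma malleable_extend_some v M :
  malleable 3 v -> perfect_matching M ->
  exists H, hamiltonian_cycle H /\ M \subset H.
Proof.
case=> _ _ _ mall pmM; have [H [hamH _]] := mall M pmM.
by exists (H ord0); apply: hamH.
Qed.

Lemma malleable_two_factor_hamiltonian v F :
  cubic G -> malleable 3 v -> two_factor F -> hamiltonian_cycle F.
Proof.
move=> cubG mallv tfF.
have pmM : perfect_matching (~: F) := regular_in_compl cubG tfF.
have [H [hamH sMH]] := malleable_extend_some mallv pmM.
have [tfH _] := hamH.
have pmN : perfect_matching (H :\: ~: F) := regular_inD sMH tfH pmM.
have pmL : perfect_matching (~: H) := regular_in_compl cubG tfH.
have /set0Pn[e] : boundary v :&: (H :\: ~: F) != set0.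
  by rewrite -card_gt0 -/(degree_in _ v) pmN.
case/setIP=> ev eN.
have eH : e \in H by move: eN; rewrite inE => /andP[].
have eNL : e \notin ~: H by rewrite inE eH.
have [H' [hamH' sLH' eH']] := malleable_extend mallv pmL ev eNL.
have pmB : perfect_matching (H' :\: ~: H) := regular_inD sLH' (proj1 hamH') pmL.
have eqBN : H' :\: ~: H = H :\: ~: F.
  apply: (perfect_matching_in_hamiltonian_eq hamH _ _ pmB pmN _ eN).
  - by rewrite setDE setCK subsetIr.
  - exact: subsetDl.
  - by rewrite inE eNL.
(* Inside [H], [F] and [H'] agree by [eqBN]; outside [H], both contain every edge, since [~: F] lies
   in [H] and [~: H] in [H']. *)
suff -> : F = H' by [].
apply/setP=> f; move/setP/(_ f): eqBN; rewrite !inE !negbK.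
have /implyP := subsetP sLH' f; have /implyP := subsetP sMH f; rewrite !inE.
by case: (f \in H) (f \in F) (f \in H') => [] [] [].
Qed.

End RegularSubgraphs.

Theorem proposition2p3 (G : multigraph) (Gconn : connected G) (Gcubic : cubic G)
    (Gmall : exists v : vertex G, malleable 3 v) :
  two_factor_hamiltonian G /\ (forall v : vertex G, malleable 3 v).
Proof.
case: Gmall => v mallv.
have ham F : two_factor F -> hamiltonian_cycle F :=
  malleable_two_factor_hamiltonian Gcubic mallv.
have [[M0 pmM0] _ _ _] := mallv.
split.
  split=> //; have [H [hamH _]] := malleable_extend_some mallv pmM0.
  by exists H.
move=> w; split=> [| | //|M pmM]; [by exists M0 | exact: Gcubic |].
have [H [hamH sMH]] := malleable_extend_some mallv pmM.
have pmN : perfect_matching (H :\: M) := regular_inD sMH (proj1 hamH) pmM.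
(* [~: (H :\: M)] is [M] together with [~: H]; it is a 2-factor, being the complement of a perfect
   matching. *)
exists (fun i => if i == ord0 then H else ~: (H :\: M)); split=> [i|].
  case: ifP => _; first by split.
  split; first exact: ham (regular_in_compl Gcubic pmN).
  by apply/subsetP=> f fM; rewrite !inE fM.
apply/subsetP=> f _; apply/bigcupP.
have [fH|fNH] := boolP (f \in H); first by exists ord0.
by exists ord_max => //=; rewrite !inE (negPf fNH) andbF.
Qed.
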